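(* Let $r$ and $s$ be positive integers, let $a$ and $b$ be integers greater than $1$, and let $c$ be any odd positive integer prime to $ra$. Then there are at most $4$ solutions in positive integers $(x,y,z)$ to the equation $$r a^x + s b^y = c^z,$$ except when this equation has a solution $(x,y,z)$ in positive integers in which $$\{ r a^x, s b^y \} = \left\{ 3\left(\frac{3^{\nu-1}-1}{8}\right), \ \frac{3^{\nu+1}-1}{8} \right\}$$ for some odd integer $\nu > 1$, with one of $a$, $b$ equal to $3$, in which case there is at most one further solution (that is, there are at most $5$ solutions in total). *)

(* Defs.v *)
From mathcomp Require Import all_boot.
From mathcomp Require Import classical_sets functions cardinality.

Set Implicit Arguments.
Unset Strict Implicit.
Unset Printing Implicit Defensive.

Local Open Scope nat_scope.

Definition is_solution (r s a b c x y z : nat) : Prop :=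
  [/\ 0 < x, 0 < y, 0 < z & r * a ^ x + s * b ^ y = c ^ z].

Definition solutions (r s a b c : nat) : set (nat * nat * nat) :=
  [set t | is_solution r s a b c t.1.1 t.1.2 t.2]%classic.

(* Both divisions by 8 are exact, as nu is odd; [=i] between the two-element
   lists is equality of the underlying unordered sets. *)
Definition exceptional (r s a b c : nat) : Prop :=
  (a = 3 \/ b = 3) /\
  exists x y z nu : nat,
    [/\ is_solution r s a b c x y z, odd nu, 1 < nu &
        [:: r * a ^ x; s * b ^ y] =i
        [:: 3 * ((3 ^ (nu - 1) - 1) %/ 8); (3 ^ (nu + 1) - 1) %/ 8]].

(* Main.v *)
Require Import Defs.
From mathcomp Require Import all_boot all_order all_algebra.
From mathcomp Require Import algC.
From mathcomp Require Import boolp classical_sets functions cardinality.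
From mathcomp Require Import zify ring.

(** Write X = r a^x and Y = s b^y for a solution; X and Y are coprime to c and
to each other.

Four classes.  The pairs (u, v) of integers with a^u = b^v modulo c form a
subgroup L of Z^2.  For every solution r a^x = - s b^y modulo c, so the
differences of the exponent pairs (x, y) of solutions lie in L.  A subgroup of
Z^2 needs at most two generators, hence L / 2L has at most four elements
([plane_subgroup_mod2]), and everything rests on how many solutions have their
differences in 2L.

One class.  Let two solutions differ by 2(u, v) with (u, v) in L.  Collecting
the common part of the powers, P = r a^x0 and Q = s b^y0 with x0, y0 > 0, both
solutions take the form P p^2 + Q q^2 = c^z, the norm equation of
alpha = p sqrt P + q sqrt (-Q), where p is a power of a and q a power of b.
That (u, v) is in L itself, and not merely 2(u, v), says that the ratios p / q
of the two solutions agree modulo c, that is, both elements alpha come from the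
same ideal factorization of c.  Among all representations with that ratio let
alpha0 have the least norm.  Dividing by alpha0^2 never leaves the class
([descent_step]), so each member of it is an odd power of alpha0 up to sign
([power_of_minimal]).

The prime divisors of p divide a, hence P, because x0 > 0; likewise those of q
divide Q.  For an odd prime l, the l-th power of an element with X = P p^2 and
Y = Q q^2 multiplies p and q by forms Phi in X and Y all of whose prime divisors
must then be l.  For l >= 5 each Phi divides l, which is too small for the norm
to be an l-th power ([Phi_size_contradiction]).  For l = 3 the factors are
X - 3Y and 3X - Y; one is a power of 3 and the other 1 up to sign, which is
exactly the exceptional family ([supported_prime_exponent]).  Cubing a second
time fails modulo 9 ([cubic_shape_cubed]).  So the only odd powers which occur
are alpha0 and alpha0^3, and alpha0^3 only above an exceptional solution
([class_collision]).

The fifth solution.  In an exceptional pair the base a is 3 and 3 divides X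
exactly once, or the same holds of b and Y; this determines that exponent, then
nu, then both summands, so that a single solution can be the cube of another
([cube_of_unique]). *)

Set Implicit Arguments.
Unset Strict Implicit.
Unset Printing Implicit Defensive.

Import Order.TTheory GRing.Theory Num.Theory.
Local Open Scope nat_scope.
Local Open Scope card_scope.
Local Open Scope ring_scope.

(** * Coprime integers *)

Lemma coprimez_no_common_prime (u v : int) (q : nat) :
  coprimez u v -> prime q -> (q %| u)%Z -> (q %| v)%Z -> False.
Proof.
move=> cuv pq qu qv; have : (q %| gcdz u v)%Z by rewrite dvdz_gcd qu qv.
rewrite (eqP cuv) -[(q %| 1)%Z]/(q %| 1)%N dvdn1 => /eqP q1.
by rewrite q1 in pq.
Qed.

Lemma coprimez_of_primes (u v : int) :
  (forall q : nat, prime q -> (q %| u)%Z -> (q %| v)%Z -> False) -> coprimez u v.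
Proof.
move=> h; rewrite coprimezE /coprime; apply/negP => /negP g1.
have [q pq] : exists2 q, prime q & (q %| gcdn `|u| `|v|)%N.
  have [g0|g_gt0] := posnP (gcdn `|u| `|v|); first by exists 2%N; rewrite ?g0.
  exists (pdiv (gcdn `|u| `|v|)); last exact: pdiv_dvd.
  by rewrite pdiv_prime // ltn_neqAle eq_sym g1.
by rewrite dvdn_gcd => /andP[qu qv]; apply: (h q).
Qed.

(** A substitute for arguing with a prime common divisor: the hypothesis is met by
an identity that writes y^2 as a combination of x and a multiple of c. *)
Lemma coprimez_of_dvd (c x y : int) : coprimez c y ->
  (forall g, (g %| c)%Z -> (g %| x)%Z -> (g %| y ^+ 2)%Z) -> coprimez c x.
Proof.
move=> cy h.
have := h _ (dvdz_gcdl c x) (dvdz_gcdr c x).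
set g := gcdz c x => gy.
have cgy : coprimez g (y ^+ 2).
  apply: coprimezXr; rewrite coprimezE; apply: coprime_dvdl cy.
  exact: (dvdz_gcdl c x).
rewrite /coprimez -/g.
move: cgy; rewrite /coprimez.
have -> : gcdz g (y ^+ 2) = `|g|%N; last by rewrite [Posz `|g|%N]gez0_abs // /g /gcdz.
rewrite /gcdz; congr Posz; apply/gcdn_idPl; exact: gy.
Qed.

(** * Representations of powers of c and descent *)

(** The element p sqrt P + q sqrt (-Q) has norm c^z and no common divisor with its
conjugate apart from prime factors of 2PQ.  The congruence c | p q' - p' q
between two of them says that their ratios p / q are equal modulo c; an ideal
factorization of c is hidden in this ratio. *)
Definition represents (c P Q : int) (z : nat) (p q : int) : Prop :=
  P * p ^+ 2 + Q * q ^+ 2 = c ^+ z /\ coprimez c p.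

Lemma represents_coprime_r c P Q z p q :
  coprimez c P -> (0 < z)%N -> represents c P Q z p q -> coprimez c q.
Proof.
move=> cP z0 [e cp].
apply: (@coprimez_of_dvd _ _ (P * p)); first by rewrite coprimezMr cP.
move=> g gc gq.
have -> : (P * p) ^+ 2 = P * c ^+ z - P * Q * q * q by rewrite -e; ring.
by apply: rpredB; [apply/dvdz_mull/dvdz_exp | apply: dvdz_mull].
Qed.

(** The quotient alpha / alpha0 is the integral element s + t sqrt (-PQ).  Indeed
alpha conj(alpha0) has second coordinate q p0 - p q0, and
P (p q0 - p0 q) (p q0 + p0 q) is divisible by c^z0, where c is coprime to the
last factor because it is odd, coprime to p q0 and divides p q0 - p0 q.  The
first coordinate follows, since its square is known modulo (c^z0)^2 from the
norm. *)
Lemma class_quotient c P Q z0 p0 q0 z p q :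
  odd `|c| -> coprimez c P -> c != 0 ->
  represents c P Q z0 p0 q0 -> represents c P Q z p q ->
  (0 < z0)%N -> (z0 <= z)%N -> (c %| p * q0 - p0 * q)%Z ->
  exists s t, [/\ s ^+ 2 + P * Q * t ^+ 2 = c ^+ (z - z0),
    p = s * p0 - t * Q * q0 & q = s * q0 + t * P * p0].
Proof.
move=> co cP c0 r0 r z0_gt0 le_z cl.
have cq0 := represents_coprime_r cP z0_gt0 r0.
have cq := represents_coprime_r cP (leq_trans z0_gt0 le_z) r.
case: r0 r => e0 cp0 [e cp].
have c2 : coprimez c 2 by rewrite coprimezE /= coprimen2.
have csum : coprimez c (p * q0 + p0 * q).
  apply: (@coprimez_of_dvd _ _ (2 * (p * q0))).
    by rewrite !coprimezMr c2 cp cq0.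
  move=> g gc gs; apply: dvdz_exp => //.
  have -> : 2 * (p * q0) = (p * q0 + p0 * q) + (p * q0 - p0 * q) by ring.
  by apply: rpredD => //; apply: dvdz_trans cl.
have : (c ^+ z0 %| p * q0 - p0 * q)%Z.
  have cc : coprimez (c ^+ z0) (P * (p * q0 + p0 * q)).
    by rewrite coprimezXl // coprimezMr cP.
  rewrite -(Gauss_dvdzr _ cc).
  have -> : P * (p * q0 + p0 * q) * (p * q0 - p0 * q) =
     (c ^+ z - Q * q ^+ 2) * q0 ^+ 2 - (c ^+ z0 - Q * q0 ^+ 2) * q ^+ 2.
    by rewrite -e -e0; ring.
  have -> : (c ^+ z - Q * q ^+ 2) * q0 ^+ 2 - (c ^+ z0 - Q * q0 ^+ 2) * q ^+ 2
    = c ^+ z * q0 ^+ 2 - c ^+ z0 * q ^+ 2 by ring.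
  by apply: rpredB; apply/dvdz_mulr => //; apply: dvdz_exp2l.
case/dvdzP => t' et.
have : (c ^+ z0 %| P * p * p0 + Q * q * q0)%Z.
  rewrite -(@dvdz_pexp2r _ _ 2) //.
  have -> : (P * p * p0 + Q * q * q0) ^+ 2 =
     c ^+ z * c ^+ z0 - P * Q * (p * q0 - p0 * q) ^+ 2.
    by rewrite -e -e0; ring.
  rewrite et; apply: rpredB.
    by rewrite expr2; apply: dvdz_mul => //; apply: dvdz_exp2l.
  by rewrite exprMn mulrA; apply: dvdz_mull.
case/dvdzP => s es.
have cz0 : c ^+ z0 != 0 by rewrite expf_neq0.
exists s, (- t'); split.
- apply: (mulIf (expf_neq0 2 cz0)).
  have -> : (s ^+ 2 + P * Q * (- t') ^+ 2) * (c ^+ z0) ^+ 2 =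
    (s * c ^+ z0) ^+ 2 + P * Q * (t' * c ^+ z0) ^+ 2 by ring.
  rewrite -es -et.
  have -> : c ^+ (z - z0) * (c ^+ z0) ^+ 2 = c ^+ z * c ^+ z0.
    have ez : (z - z0 + z0 * 2 = z + z0)%N by rewrite muln2 -addnn addnA subnK.
    by rewrite -exprM -!exprD ez.
  rewrite -e -e0; ring.
- apply: (mulIf cz0).
  have -> : (s * p0 - - t' * Q * q0) * c ^+ z0 =
    (s * c ^+ z0) * p0 + (t' * c ^+ z0) * Q * q0 by ring.
  rewrite -es -et -e0; ring.
- apply: (mulIf cz0).
  have -> : (s * q0 + - t' * P * p0) * c ^+ z0 =
    (s * c ^+ z0) * q0 - (t' * c ^+ z0) * P * p0 by ring.
  rewrite -es -et -e0; ring.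
Qed.

(** Divisibility of beta conj(alpha0), with beta = s + t sqrt (-PQ), when
beta alpha0 is divisible by no prime factor of c: the product of the second
coordinates s q0 + t P p0 and t P p0 - s q0 of beta alpha0 and beta conj(alpha0)
is divisible by c^m, and c is coprime to the first of them. *)
Lemma class_quotient_conj c P Q z0 p0 q0 w s t m :
  c != 0 -> coprimez c P -> P * p0 ^+ 2 + Q * q0 ^+ 2 = c ^+ z0 ->
  s ^+ 2 + P * Q * t ^+ 2 = c ^+ w -> coprimez c (s * q0 + t * P * p0) ->
  (m <= w)%N -> (m <= z0)%N ->
  exists p3 q3, [/\ c ^+ m * p3 = s * p0 + t * Q * q0,
     c ^+ m * q3 = t * P * p0 - s * q0 &
     P * p3 ^+ 2 + Q * q3 ^+ 2 = c ^+ (w + z0 - 2 * m)].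
Proof.
move=> c0 cP e0 e cq mw mz.
have dq : (c ^+ m %| t * P * p0 - s * q0)%Z.
  rewrite -(Gauss_dvdzr _ (coprimezXl m cq)).
  have -> : (s * q0 + t * P * p0) * (t * P * p0 - s * q0) =
     t ^+ 2 * P * c ^+ z0 - c ^+ w * q0 ^+ 2 by rewrite -e -e0; ring.
  apply: rpredB; first by apply/dvdz_mull/dvdz_exp2l.
  by apply/dvdz_mulr/dvdz_exp2l.
have nrm : P * (s * p0 + t * Q * q0) ^+ 2 + Q * (t * P * p0 - s * q0) ^+ 2 =
   c ^+ w * c ^+ z0 by rewrite -e -e0; ring.
have dp : (c ^+ m %| s * p0 + t * Q * q0)%Z.
  rewrite -(@dvdz_pexp2r _ _ 2) //.
  rewrite -(Gauss_dvdzr _ (coprimezXl 2 (coprimezXl m cP))).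
  have -> : P * (s * p0 + t * Q * q0) ^+ 2 =
    c ^+ w * c ^+ z0 - Q * (t * P * p0 - s * q0) ^+ 2 by rewrite -nrm; ring.
  apply: rpredB; first by rewrite expr2; apply: dvdz_mul; apply: dvdz_exp2l.
  by apply/dvdz_mull/dvdz_exp2r.
case/dvdzP: dq => q3 eq3; case/dvdzP: dp => p3 ep3.
have cm : c ^+ m != 0 by rewrite expf_neq0.
exists p3, q3; split; [by rewrite ep3 mulrC | by rewrite eq3 mulrC | ].
apply: (mulIf (expf_neq0 2 cm)).
have -> : (P * p3 ^+ 2 + Q * q3 ^+ 2) * (c ^+ m) ^+ 2 =
  P * (p3 * c ^+ m) ^+ 2 + Q * (q3 * c ^+ m) ^+ 2 by ring.
have ew : (w + z0 = w + z0 - 2 * m + m * 2)%N.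
  by rewrite mulnC subnK // mulnC mul2n -addnn leq_add.
by rewrite -ep3 -eq3 nrm -exprM -!exprD -ew.
Qed.

(** Modulo each prime factor of c the ratios p / q and p0 / q0 are equal up to
sign.  Coprimality of c with p q0 + p0 q excludes the minus sign everywhere at
once. *)
Lemma same_orientation c P Q z0 p0 q0 z p q :
  coprimez c P -> (0 < z0)%N -> (0 < z)%N ->
  P * p0 ^+ 2 + Q * q0 ^+ 2 = c ^+ z0 -> P * p ^+ 2 + Q * q ^+ 2 = c ^+ z ->
  coprimez c (p * q0 + p0 * q) -> (c %| p * q0 - p0 * q)%Z.
Proof.
move=> cP z0_gt0 z_gt0 e0 e cs.
have cc : coprimez c (P * (p * q0 + p0 * q)) by rewrite coprimezMr cP.
rewrite -(Gauss_dvdzr _ cc).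
have -> : P * (p * q0 + p0 * q) * (p * q0 - p0 * q) =
    c ^+ z * q0 ^+ 2 - c ^+ z0 * q ^+ 2 by rewrite -e -e0; ring.
by apply: rpredB; apply/dvdz_mulr/dvdz_exp.
Qed.

Lemma norm_neq1 (P Q p q : int) :
  2 <= P -> 2 <= Q -> P * p ^+ 2 + Q * q ^+ 2 <> 1.
Proof.
move=> P2 Q2.
have hp := sqr_ge0 p; have hq := sqr_ge0 q.
move: (p ^+ 2) (q ^+ 2) hp hq => u v u0 v0 e.
have hu : 2 * u <= P * u by rewrite ler_wpM2r.
have hv : 2 * v <= Q * v by rewrite ler_wpM2r.
have eu : u = 0 by lia.
have ev : v = 0 by lia.
by move: e; rewrite eu ev !mulr0.
Qed.

Lemma pell_norm1 (P Q s t : int) :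
  2 <= P -> 2 <= Q -> s ^+ 2 + P * Q * t ^+ 2 = 1 -> t = 0.
Proof.
move=> P2 Q2 e; apply/eqP; case: (eqVneq t 0) => // tn.
have t1 : 1 <= t ^+ 2 by rewrite -gtz0_ge1 exprn_even_gt0.
have PQ4 : 2 * 2 <= P * Q by apply: ler_pM.
have s0 := sqr_ge0 s.
have : P * Q * 1 <= P * Q * t ^+ 2 by rewrite ler_wpM2l //; lia.
by move: (s ^+ 2) (P * Q) (P * Q * t ^+ 2) e PQ4 s0 => u D Dv; lia.
Qed.

(** Let alpha and alpha0 have norms c^z and c^z0.  If z = z0 their quotient is a
unit.  Otherwise alpha conj(alpha0)^2 is divisible by c^(min z (2 z0)).  For
z >= 2 z0 this gives alpha / alpha0^2; z = 2 z0 would give an element of norm 1,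
impossible as P, Q >= 2.  For z < 2 z0 it gives, up to conjugation,
alpha0^2 / alpha, whose norm c^(2 z0 - z) is less than that of alpha0. *)
Lemma descent_step c P Q z0 p0 q0 z p q :
  odd `|c| -> coprimez c P -> c != 0 -> 2 <= P -> 2 <= Q ->
  represents c P Q z0 p0 q0 -> represents c P Q z p q ->
  (0 < z0)%N -> (z0 <= z)%N -> (c %| p * q0 - p0 * q)%Z ->
  [\/ (p = p0 /\ q = q0) \/ (p = - p0 /\ q = - q0),
     exists p3 q3, [/\ (2 * z0 < z)%N, represents c P Q (z - 2 * z0) p3 q3,
       (c %| p3 * q0 - p0 * q3)%Z,
       p = (P * p0 ^+ 2 - Q * q0 ^+ 2) * p3 - 2 * p0 * q0 * Q * q3 &
       q = (P * p0 ^+ 2 - Q * q0 ^+ 2) * q3 + 2 * p0 * q0 * P * p3] |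
     exists z3 p3 q3, [/\ (0 < z3)%N, (z3 < z0)%N, represents c P Q z3 p3 q3 &
       (c %| p3 * q0 - p0 * q3)%Z]].
Proof.
move=> co cP c0 P2 Q2 r0 r z0_gt0 le_z cl.
have [s [t [en ep eq]]] :=
  class_quotient co cP c0 r0 r z0_gt0 le_z cl.
have cq0 := represents_coprime_r cP z0_gt0 r0.
have cq := represents_coprime_r cP (leq_trans z0_gt0 le_z) r.
case: (r0) (r) => e0 cp0 [e cp].
have [ez|z_neq] := eqVneq z z0.
  apply: Or31; move: en; rewrite ez subnn expr0 => en.
  have t0 := pell_norm1 P2 Q2 en.
  move: en; rewrite t0 expr0n mulr0 addr0 => /eqP; rewrite sqrf_eq1.
  case/orP => /eqP es; [left|right]; rewrite ep eq t0 es; split; ring.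
have w_gt0 : (0 < z - z0)%N by rewrite subn_gt0 ltn_neqAle eq_sym z_neq.
have cq' : coprimez c (s * q0 + t * P * p0) by rewrite -eq.
have [le_w|lt_w] := leqP z0 (z - z0).
  apply: Or32.
  have [p3 [q3 [ep3 eq3 n3]]] :=
    class_quotient_conj c0 cP e0 en cq' le_w (leqnn z0).
  have ez : (z - z0 + z0 - 2 * z0 = z - 2 * z0)%N by rewrite subnK.
  rewrite {}ez in n3.
  (* z = 2 z0 would leave an element of norm 1 *)
  have z3_gt0 : (2 * z0 < z)%N.
    rewrite ltnNge; apply/negP => hz; move: n3.
    by rewrite (eqP (_ : z - 2 * z0 == 0)%N) ?subn_eq0 //; apply: norm_neq1.
  have cz0 : c ^+ z0 != 0 by rewrite expf_neq0.
  have es : s = P * p3 * p0 - Q * q3 * q0.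
    apply: (mulfI cz0).
    have -> : c ^+ z0 * (P * p3 * p0 - Q * q3 * q0) =
      P * p0 * (c ^+ z0 * p3) - Q * q0 * (c ^+ z0 * q3) by ring.
    rewrite ep3 eq3 -e0; ring.
  have et : t = p3 * q0 + p0 * q3.
    apply: (mulfI cz0).
    have -> : c ^+ z0 * (p3 * q0 + p0 * q3) =
      q0 * (c ^+ z0 * p3) + p0 * (c ^+ z0 * q3) by ring.
    rewrite ep3 eq3 -e0; ring.
  have ct : coprimez c t.
    apply: (@coprimez_of_dvd _ _ p) => // g gc gt.
    have -> : p ^+ 2 = p0 ^+ 2 * c ^+ (z - z0) +
       t * (t * Q ^+ 2 * q0 ^+ 2 - 2 * s * p0 * Q * q0 - P * Q * t * p0 ^+ 2).
      by rewrite -en ep; ring.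
    by apply: rpredD; [apply/dvdz_mull/dvdz_exp|apply: dvdz_mulr].
  have ep' : p = (P * p0 ^+ 2 - Q * q0 ^+ 2) * p3 - 2 * p0 * q0 * Q * q3.
    by rewrite ep es et; ring.
  have z3' : (0 < z - 2 * z0)%N by rewrite subn_gt0.
  have cp3 : coprimez c p3.
    apply: (@coprimez_of_dvd _ _ p) => // g gc gp.
    have -> : p ^+ 2 = 4 * p0 ^+ 2 * q0 ^+ 2 * Q * c ^+ (z - 2 * z0) +
       p3 * ((P * p0 ^+ 2 - Q * q0 ^+ 2) ^+ 2 * p3
             - 4 * (P * p0 ^+ 2 - Q * q0 ^+ 2) * p0 * q0 * Q * q3
             - 4 * p0 ^+ 2 * q0 ^+ 2 * Q * P * p3).
      by rewrite -n3 ep'; ring.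
    by apply: rpredD; [apply/dvdz_mull/dvdz_exp|apply: dvdz_mulr].
  exists p3, q3; split=> //; last by rewrite eq es et; ring.
  by apply: (same_orientation cP z0_gt0 z3' e0 n3);
     rewrite -et.
apply: Or33.
have [p3 [q3 [ep3 eq3 n3]]] :=
  class_quotient_conj c0 cP e0 en cq' (leqnn _) (ltnW lt_w).
set w := (z - z0)%N in en w_gt0 lt_w ep3 eq3 n3.
have ez : (w + z0 - 2 * w = z0 - w)%N by rewrite mul2n -addnn subnDl.
rewrite {}ez in n3.
have z3_gt0 : (0 < z0 - w)%N by rewrite subn_gt0.
have cw : c ^+ w != 0 by rewrite expf_neq0.
have ep0 : p0 = s * p3 + t * Q * q3.
  apply: (mulfI cw).
  have -> : c ^+ w * (s * p3 + t * Q * q3) =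
    s * (c ^+ w * p3) + t * Q * (c ^+ w * q3) by ring.
  rewrite ep3 eq3 -en; ring.
have eq0 : q0 = t * P * p3 - s * q3.
  apply: (mulfI cw).
  have -> : c ^+ w * (t * P * p3 - s * q3) =
    t * P * (c ^+ w * p3) - s * (c ^+ w * q3) by ring.
  rewrite ep3 eq3 -en; ring.
have cp3 : coprimez c p3.
  apply: (@coprimez_of_dvd _ _ p0) => // g gc gp.
  have -> : p0 ^+ 2 = t ^+ 2 * Q * c ^+ (z0 - w) +
    p3 * (s ^+ 2 * p3 + 2 * s * t * Q * q3 - t ^+ 2 * Q * P * p3).
    by rewrite -n3 ep0; ring.
  by apply: rpredD; [apply/dvdz_mull/dvdz_exp|apply: dvdz_mulr].
(* the conjugate has the ratio of alpha0; p3, q3 itself has the opposite one *)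
have n3' : P * p3 ^+ 2 + Q * (- q3) ^+ 2 = c ^+ (z0 - w) by rewrite sqrrN.
exists (z0 - w)%N, p3, (- q3); split=> //.
  by rewrite -[X in (_ < X)%N]subn0 ltn_sub2l.
apply: (same_orientation cP z0_gt0 z3_gt0 e0 n3').
apply: (@coprimez_of_dvd _ _ (2 * (p3 * q0))).
  by rewrite !coprimezMr cp3 cq0 coprimezE /= coprimen2 co.
move=> g gc gs; apply: dvdz_exp => //.
have -> : 2 * (p3 * q0) = (p3 * q0 + p0 * - q3) + t * c ^+ (z0 - w).
  by rewrite -n3 ep0 eq0; ring.
by apply: rpredD => //; apply/dvdz_mull/dvdz_exp.
Qed.

Lemma orientation_trans c p q p1 q1 p0 q0 : coprimez c q1 ->
  (c %| p * q1 - p1 * q)%Z -> (c %| p0 * q1 - p1 * q0)%Z ->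
  (c %| p * q0 - p0 * q)%Z.
Proof.
move=> cq1 h h0; rewrite -(Gauss_dvdzr _ cq1).
have -> : q1 * (p * q0 - p0 * q) =
  (p * q1 - p1 * q) * q0 - (p0 * q1 - p1 * q0) * q by ring.
by apply: rpredB; apply: dvdz_mulr.
Qed.

Lemma minimal_representation c P Q z1 p1 q1 :
  (0 < z1)%N -> represents c P Q z1 p1 q1 ->
  exists z0 p0 q0, [/\ (0 < z0)%N, represents c P Q z0 p0 q0,
    (c %| p0 * q1 - p1 * q0)%Z &
    forall z p q, (0 < z)%N -> represents c P Q z p q ->
      (c %| p * q1 - p1 * q)%Z -> (z0 <= z)%N].
Proof.
move=> z1_gt0 r1.
pose R z := (0 < z)%N /\ exists p q, represents c P Q z p q /\
  (c %| p * q1 - p1 * q)%Z.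
have exR : exists z, `[< R z >].
  exists z1; apply/asboolP; split=> //; exists p1, q1; split=> //.
  by rewrite subrr dvdz0.
have [z0 /asboolP[z0_gt0 [p0 [q0 [r0 h0]]]] min0] := ex_minnP exR.
exists z0, p0, q0; split=> // z p q z_gt0 r h.
by apply: min0; apply/asboolP; split=> //; exists p, q.
Qed.

(** By minimality [descent_step] can only divide by alpha0^2 or stop at a sign.
The sign is kept inside the base, as the exponent is odd. *)
Lemma power_of_minimal c P Q (K : comNzRingType) (A B : K) z0 p0 q0 z p q :
  odd `|c| -> coprimez c P -> c != 0 -> 2 <= P -> 2 <= Q ->
  A ^+ 2 = P%:~R -> B ^+ 2 = - Q%:~R ->
  (0 < z0)%N -> represents c P Q z0 p0 q0 ->
  (forall z p q, (0 < z)%N -> represents c P Q z p q ->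
      (c %| p * q0 - p0 * q)%Z -> (z0 <= z)%N) ->
  (0 < z)%N -> represents c P Q z p q -> (c %| p * q0 - p0 * q)%Z ->
  exists m p' q', [/\ odd m, (p' = p0 /\ q' = q0) \/ (p' = - p0 /\ q' = - q0) &
    p%:~R * A + q%:~R * B = (p'%:~R * A + q'%:~R * B) ^+ m].
Proof.
move=> co cP c0 P2 Q2 eA eB z0_gt0 r0 min0.
elim/ltn_ind: z p q => z IH p q z_gt0 r h.
have le_z := min0 _ _ _ z_gt0 r h.
case: (descent_step co cP c0 P2 Q2 r0 r z0_gt0 le_z h).
- by move=> e; exists 1%N, p, q; split; rewrite ?expr1.
- move=> [p3 [q3 [lt2 r3 h3 ep eq]]].
  have z3_gt0 : (0 < z - 2 * z0)%N by rewrite subn_gt0.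
  have lt3 : (z - 2 * z0 < z)%N.
    by rewrite -[X in (_ < X)%N]subn0 ltn_sub2l // muln_gt0.
  have [m [p' [q' [om e' em]]]] := IH _ lt3 _ _ z3_gt0 r3 h3.
  exists m.+2, p', q'; split=> //; first by rewrite /= negbK.
  rewrite -addn2 exprD -em.
  have -> : (p'%:~R * A + q'%:~R * B) ^+ 2 = (p0%:~R * A + q0%:~R * B) ^+ 2.
    by case: e' => -[-> ->] //; rewrite !mulrNz !mulNr -opprD sqrrN.
  have -> : (p0%:~R * A + q0%:~R * B) ^+ 2 =
     p0%:~R ^+ 2 * A ^+ 2 + q0%:~R ^+ 2 * B ^+ 2 +
     2 * p0%:~R * q0%:~R * A * B by ring.
  have -> : (p3%:~R * A + q3%:~R * B) *
     (p0%:~R ^+ 2 * A ^+ 2 + q0%:~R ^+ 2 * B ^+ 2 +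
      2 * p0%:~R * q0%:~R * A * B) =
     (p3%:~R * A + q3%:~R * B) *
     (p0%:~R ^+ 2 * A ^+ 2 + q0%:~R ^+ 2 * B ^+ 2) +
      2 * p0%:~R * q0%:~R * (p3%:~R * B * A ^+ 2 + q3%:~R * A * B ^+ 2) by ring.
  rewrite eA eB ep eq; ring.
- move=> [z3 [p3 [q3 [z3_gt0 lt3 r3 h3]]]].
  by have := min0 _ _ _ z3_gt0 r3 h3; rewrite leqNgt lt3.
Qed.

(** * Odd powers of a binomial *)

(** The cofactor of sqrt u in (sqrt u + sqrt v)^(2h+1).  It is one form for both
cofactors because the binomial coefficients are symmetric: the other one is
Phi h v u. *)
Definition Phi {K : comNzRingType} (h : nat) (u v : K) : K :=
  \sum_(j < h.+1) (u ^+ (h - j) * v ^+ j) *+ 'C((2 * h).+1, 2 * j).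

Lemma sum_odd_even (K : comNzRingType) (f : nat -> K) n :
  \sum_(i < 2 * n) f i = \sum_(j < n) f (2 * j)%N + \sum_(j < n) f (2 * j).+1.
Proof.
elim: n => [|n IH]; first by rewrite muln0 !big_ord0 addr0.
by rewrite mulnS add2n !big_ord_recr /= IH; ring.
Qed.

Lemma odd_power_split (K : comNzRingType) h (A B : K) :
  (A + B) ^+ (2 * h).+1 =
  A * Phi h (A ^+ 2) (B ^+ 2) + B * Phi h (B ^+ 2) (A ^+ 2).
Proof.
rewrite exprDn.
have -> : (2 * h).+2 = (2 * h.+1)%N by lia.
rewrite (sum_odd_even
  (fun i => A ^+ ((2 * h).+1 - i) * B ^+ i *+ 'C((2 * h).+1, i))).
congr (_ + _).
  rewrite /Phi mulr_sumr; apply: eq_bigr => -[j hj] _ /=.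
  rewrite -mulrnAr -!exprM -!mulrnAr mulrA -exprS; congr (_ ^+ _ * _); lia.
rewrite [in RHS]/Phi (reindex_inj rev_ord_inj) /= mulr_sumr.
apply: eq_bigr => -[j hj] _ /=.
rewrite -bin_sub; last by lia.
rewrite !subSS -!exprM (_ : 2 * h - 2 * (h - j) = 2 * j)%N; last by lia.
rewrite (exprS B (2 * (h - j))) mulrnAr; congr (_ *+ _).
by rewrite mulrCA [A ^+ _ * _]mulrC.
Qed.

Lemma Phi_intr (K : comNzRingType) h (u v : int) :
  (Phi h u v)%:~R = Phi h u%:~R v%:~R :> K.
Proof.
rewrite /Phi rmorph_sum; apply: eq_bigr => j _ /=.
by rewrite rmorphMn /= rmorphM !rmorphXn.
Qed.

(** The norm of an odd power, over square roots of u and v in the algebraic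
numbers: multiply [odd_power_split] for A + B and for A - B. *)
Lemma Phi_norm h (u v : int) :
  u * Phi h u v ^+ 2 - v * Phi h v u ^+ 2 = (u - v) ^+ (2 * h).+1.
Proof.
apply: (@intr_inj algC).
pose A : algC := sqrtC u%:~R; pose B : algC := sqrtC v%:~R.
have eA : A ^+ 2 = u%:~R by exact: sqrtCK.
have eB : B ^+ 2 = v%:~R by exact: sqrtCK.
have e1 := odd_power_split h A B.
have := odd_power_split h A (- B); rewrite sqrrN => e2.
have : (A ^+ 2 - B ^+ 2) ^+ (2 * h).+1 = ((A + B) * (A - B)) ^+ (2 * h).+1.
  by congr (_ ^+ _); ring.
rewrite exprMn e1 e2 eA eB -!Phi_intr => e.
rewrite !(rmorphXn, rmorphB, rmorphM) /=.
by rewrite e -eA -eB; ring.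
Qed.

Lemma Phi_1 (u v : int) : Phi 1 u v = u + 3 * v.
Proof.
rewrite /Phi !big_ord_recr big_ord0 /= add0r bin0 mulr1n subnn !expr1 !expr0.
by rewrite mulr1 mul1r (_ : 'C(_, _) = 3)%N // -mulr_natl.
Qed.

Lemma dvd_prime_of_no_square n l : prime l ->
  (forall q, prime q -> (q %| n)%N -> q = l) -> ~~ (l ^ 2 %| n)%N -> (n %| l)%N.
Proof.
move=> pl h hl.
have n_gt0 : (0 < n)%N by rewrite lt0n; apply: contraNneq hl => ->; rewrite dvdn0.
have pn : l.-nat n by apply/pnatP => // q pq qn; rewrite (h q pq qn) inE /= eqxx.
have [e en] := p_natP pn; case: (leqP e 1) => he.
  by rewrite en -{2}(expn1 l) dvdn_exp2l.
by move: hl; rewrite en dvdn_exp2l.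
Qed.

(** Put l = 2h + 1.  The last term of Phi is l v^h and u divides the others, so a
prime divisor of both Phi and u divides l.  If l divides u then the other terms
are divisible by l^2: the middle coefficients contain l, and the first term u^h
has h >= 2.  Hence l divides Phi at most once.  The case l = 3 escapes exactly
because of u^h. *)
Lemma Phi_prime_dvd h (u v : int) : (1 < h)%N -> prime (2 * h).+1 ->
  coprimez u v ->
  (forall q : nat, prime q -> (q %| Phi h u v)%Z -> (q %| u)%Z) ->
  (`|Phi h u v| %| (2 * h).+1)%N.
Proof.
move=> h1 pl cuv sup; set l := (2 * h).+1 in pl *.
have nv (q : nat) : prime q -> (q %| u)%Z -> ~~ (q %| v ^+ h)%Z.
  by move=> pq qu; apply/negP; apply: coprimez_no_common_prime (coprimezXr h cuv) pq qu.
pose T := \sum_(j < h) (u ^+ (h - j) * v ^+ j) *+ 'C(l, 2 * j).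
have eT : Phi h u v = T + l%:Z * v ^+ h.
  rewrite /Phi big_ord_recr /= subnn expr0 mul1r -/T; congr (_ + _).
  by rewrite -/l binSn -mulr_natl natz.
apply: dvd_prime_of_no_square => //.
- move=> q pq qF.
  have qu := sup q pq qF.
  have qT : (q %| T)%Z.
    rewrite /T; apply: rpred_sum => -[j hj] _ /=.
    by rewrite -mulr_natl; apply: dvdz_mull; apply: dvdz_mulr;
       apply: dvdz_exp; rewrite ?subn_gt0.
  have : (q %| l%:Z * v ^+ h)%Z.
    rewrite (_ : l%:Z * v ^+ h = Phi h u v - T); last by rewrite eT; ring.
    by apply: rpredB.
  rewrite Gauss_dvdzl; last first.
    by rewrite coprimezE /= prime_coprime //; apply: nv.
  by rewrite dvdzE /= dvdn_prime2 // => /eqP.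
- apply/negP => l2F.
  have lF : (l %| Phi h u v)%Z by apply: dvdn_trans l2F; rewrite dvdn_exp.
  have lu := sup l pl lF.
  have lT : ((l ^ 2)%N %| T)%Z.
    rewrite /T; apply: rpred_sum => -[j hj] _ /=.
    rewrite -mulr_natl natz mulrA; apply: dvdz_mulr.
    have [->|j0] := posnP j.
      rewrite bin0 mul1r subn0 -mulnn PoszM -expr2.
      exact: dvdz_trans (dvdz_exp2r 2 lu) (dvdz_exp2l u h1).
    rewrite -[X in (X %| _)%Z]/((l * l)%:Z) PoszM dvdz_mul //.
      by rewrite dvdzE /= prime_dvd_bin //; lia.
    by apply: dvdz_exp; rewrite ?subn_gt0.
  have : ((l ^ 2)%N %| l%:Z * v ^+ h)%Z.
    rewrite (_ : l%:Z * v ^+ h = Phi h u v - T); last by rewrite eT; ring.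
    by apply: rpredB.
  rewrite -[X in (X %| _)%Z]/((l * l)%:Z) PoszM dvdz_mul2l //.
  by apply/negP/nv.
Qed.

(** * Prime exponents under a restriction on prime divisors *)

Definition supported_on (p P : int) : Prop :=
  forall q : nat, prime q -> (q %| p)%Z -> (q %| P)%Z.

Lemma supported_factor p p' P : supported_on (p * p') P -> supported_on p P.
Proof. by move=> h q pq qp; apply: h => //; apply: dvdz_mulr. Qed.

(** Both values are at most l = 2h + 1, while the norm equation
X F^2 + Y G^2 = (X + Y)^l makes (X + Y)^(2h) at most l^2. *)
Lemma Phi_size_contradiction h (X Y : int) :
  (1 < h)%N -> 0 < X -> 0 < Y -> 5 <= X + Y ->
  (`|Phi h X (- Y)| %| (2 * h).+1)%N -> (`|Phi h (- Y) X| %| (2 * h).+1)%N -> False.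
Proof.
move=> h1 X0 Y0 N5 dF dG.
have sq (x : int) : (`|x| %| (2 * h).+1)%N -> x ^+ 2 <= ((2 * h).+1%:Z) ^+ 2.
  move=> /dvdn_leq le; rewrite -[x ^+ 2]real_normK ?num_real // ler_sqr ?nnegrE //.
  by rewrite -abszE lez_nat le.
have := Phi_norm h X (- Y); rewrite opprK.
have hF := sq _ dF; have hG := sq _ dG.
set F := Phi h X (- Y) in hF *; set G := Phi h (- Y) X in hG *.
set l := (2 * h).+1 in hF hG * => e.
have e' : (X + Y) ^+ l <= (X + Y) * (l%:Z) ^+ 2.
  rewrite -e mulrDl mulNr opprK.
  by apply: lerD; rewrite ler_wpM2l // ltW.
move: e'; rewrite /l exprS ler_pM2l; last by lia.
have N0 : 0 <= X + Y by apply: le_trans N5.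
rewrite mulnC exprM ler_sqr ?nnegrE ?exprn_ge0 //.
have : 5 ^+ h <= (X + Y) ^+ h by apply: lerXn2r.
have : (h * 2).+1%:Z < 5 ^+ h.
  clear -h1; elim: h h1 => // -[|h] IH _ //.
  case: h IH => [//|h] IH; have := IH isT.
  by rewrite [X in _ -> _ < X]exprS; move: (5 ^+ _) => t; lia.
lia.
Qed.

Lemma power_of_3 (F : int) :
  (forall q : nat, prime q -> (q %| F)%Z -> q = 3%N) -> F != 0 ->
  exists e, `|F| = 3 ^+ e.
Proof.
move=> h F0.
have pn : (3%N).-nat `|F|%N.
  apply/pnatP; first by rewrite absz_gt0.
  by move=> q pq qF; rewrite (h q pq qF) inE.
by have [e en] := p_natP pn; exists e; rewrite -abszE en -natz natrX.
Qed.

(** X = 3 (3^(nu - 1) - 1) / 8 and Y = (3^(nu + 1) - 1) / 8, without divisions. *)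
Definition cubic_shape (nu : nat) (X Y : int) : Prop :=
  [/\ odd nu, (1 < nu)%N, 8 * X + 3 = 3 ^+ nu & 8 * Y + 1 = 3 ^+ nu.+1].

Lemma pow3_mod8 n : (3 : int) ^+ n = 8 * ((3 ^+ n) %/ 8)%Z + (if odd n then 3 else 1).
Proof.
elim: n => [|n IH] //=; rewrite exprS.
move: IH; move: (_ ^+ n) => t; case: (odd n) => /=; lia.
Qed.

(** Eliminating Y gives 8X = 3 eta - delta 3^e with signs eta and delta.
Positivity of X and the residues 1, 3 of powers of 3 modulo 8 leave
eta = delta = -1 and e odd. *)
Lemma cubic_shape_of_norms e (X Y : int) : 0 < X -> 0 < Y ->
  `|X - 3 * Y| = 3 ^+ e -> `|3 * X - Y| = 1 -> cubic_shape e X Y.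
Proof.
move=> X0 Y0 eF eG.
have T0 : (0 : int) < 3 ^+ e by rewrite exprn_gt0.
have hm := pow3_mod8 e.
have e_eq : e = 0%N \/ e = 1%N \/ (1 < e)%N by lia.
rewrite /cubic_shape exprS.
case: e_eq => [e0|[e1|e2]].
- by move: eF; rewrite e0 expr0 => eF; lia.
- by move: eF; rewrite e1 expr1 => eF; lia.
have T3 : (3 : int) <= 3 ^+ e by rewrite -[X in X <= _]expr1 ler_weXn2l // ltnW.
move: hm T0 T3 eF; move: (3 ^+ e) => T.
by case: (odd e) => hm T0 T3 eF; split=> //; lia.
Qed.

(** For l = 3 the two factors are X - 3Y and 3X - Y; both are powers of 3 up to
sign, and they cannot both be divisible by 3, since 3 would then divide the
coprime integers X and Y. *)
Lemma supported_prime_exponent h (X Y : int) : prime (2 * h).+1 ->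
  0 < X -> 0 < Y -> 5 <= X + Y -> coprimez X Y ->
  supported_on (Phi h X (- Y)) X -> supported_on (Phi h (- Y) X) Y ->
  h = 1%N /\ exists nu, cubic_shape nu X Y \/ cubic_shape nu Y X.
Proof.
move=> pl X0 Y0 N5 cXY sF sG.
have cXY' : coprimez X (- Y) by rewrite coprimezN.
have [h1|h1] := ltnP 1 h.
  exfalso; apply: (@Phi_size_contradiction h X Y) => //.
    exact: Phi_prime_dvd.
  apply: Phi_prime_dvd => //; first by rewrite coprimez_sym.
  by move=> q pq qG; rewrite rpredN; apply: sG.
have eh : h = 1%N by case: h h1 pl {sF sG} => [|[|]].
split=> //; move: sF sG; rewrite eh !Phi_1 mulrN => sF sG.
(* a common prime of U - 3V and U divides 3V but not V *)
have p3 (U V : int) : coprimez U V -> supported_on (U - 3 * V) U ->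
  forall q : nat, prime q -> (q %| U - 3 * V)%Z -> q = 3%N.
  move=> cUV s q pq qd; have qU := s q pq qd.
  have : (q %| 3 * V)%Z.
    by rewrite (_ : 3 * V = U - (U - 3 * V)); [apply: rpredB | ring].
  rewrite Gauss_dvdzl; first by rewrite dvdzE /= dvdn_prime2 // => /eqP.
  rewrite coprimezE /= prime_coprime //; apply/negP => qV.
  exact: coprimez_no_common_prime cUV pq qU qV.
have sG' : supported_on (Y - 3 * X) Y.
  by move=> q pq qG; apply: sG => //; rewrite -rpredN opprD opprK.
have cYX : coprimez Y X by rewrite coprimez_sym.
have F0 : X - 3 * Y != 0.
  apply/negP => /eqP F0; have := p3 _ _ cXY sF 2 isT.
  by rewrite F0 dvdz0 => /(_ isT).
have G0 : Y - 3 * X != 0.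
  apply/negP => /eqP G0; have := p3 _ _ cYX sG' 2 isT.
  by rewrite G0 dvdz0 => /(_ isT).
have [e ee] := power_of_3 (p3 _ _ cXY sF) F0.
have [f ef] := power_of_3 (p3 _ _ cYX sG') G0.
have d3 (U V : int) k : supported_on (U - 3 * V) U -> (0 < k)%N ->
   `|U - 3 * V| = 3 ^+ k -> (3%N %| U)%Z.
  move=> s k0 ek; apply: s => //; rewrite dvdzE /=.
  by have := dvdz_exp k0 (dvdzz 3); rewrite -ek dvdzE.
have [e0|e_gt0] := posnP e; last first.
  have [f0|f_gt0] := posnP f; last first.
    exfalso; apply: (coprimez_no_common_prime (q := 3%N) cXY) => //.
      exact: d3 e_gt0 ee.
    exact: d3 f_gt0 ef.
  exists e; left; apply: cubic_shape_of_norms => //.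
  by rewrite -normrN opprB ef f0.
exists f; right; apply: cubic_shape_of_norms => //.
by rewrite -normrN opprB ee e0.
Qed.

(** * Odd powers of p sqrt P + q sqrt (-Q) *)

(** With [pow_im], the coordinates of (p sqrt P + q sqrt (-Q))^(2h+1). *)
Definition pow_re (P Q : int) h (p q : int) : int :=
  p * Phi h (P * p ^+ 2) (- (Q * q ^+ 2)).
Definition pow_im (P Q : int) h (p q : int) : int :=
  q * Phi h (- (Q * q ^+ 2)) (P * p ^+ 2).

Lemma odd_power_rep (K : comNzRingType) (A B : K) (P Q p q : int) h :
  A ^+ 2 = P%:~R -> B ^+ 2 = - Q%:~R ->
  (p%:~R * A + q%:~R * B) ^+ (2 * h).+1 =
  (pow_re P Q h p q)%:~R * A + (pow_im P Q h p q)%:~R * B.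
Proof.
move=> eA eB; rewrite odd_power_split.
have -> : (p%:~R * A) ^+ 2 = (P * p ^+ 2)%:~R.
  by rewrite exprMn eA rmorphM rmorphXn mulrC.
have -> : (q%:~R * B) ^+ 2 = (- (Q * q ^+ 2))%:~R.
  by rewrite exprMn eB rmorphN rmorphM rmorphXn /= mulrN mulrC.
rewrite -!Phi_intr /pow_re /pow_im !intrM; ring.
Qed.

Lemma pow_norm (P Q p q : int) h :
  P * pow_re P Q h p q ^+ 2 + Q * pow_im P Q h p q ^+ 2 =
  (P * p ^+ 2 + Q * q ^+ 2) ^+ (2 * h).+1.
Proof.
have := Phi_norm h (P * p ^+ 2) (- (Q * q ^+ 2)); rewrite opprK => <-.
rewrite /pow_re /pow_im; ring.
Qed.

(** P (p - p')^2 and Q (q - q')^2 are nonnegative with sum 0. *)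
Lemma quadratic_coords_inj (A B : algC) (P Q p q p' q' : int) :
  0 < P -> 0 < Q -> A ^+ 2 = P%:~R -> B ^+ 2 = - Q%:~R ->
  p%:~R * A + q%:~R * B = p'%:~R * A + q'%:~R * B -> p = p' /\ q = q'.
Proof.
move=> P0 Q0 eA eB e.
have : P * (p - p') ^+ 2 + Q * (q - q') ^+ 2 = 0.
  apply: (@intr_inj algC); rewrite !(rmorphB, rmorphD, rmorphM, rmorphXn) /=.
  have -> : Q%:~R = - (B ^+ 2) by rewrite eB opprK.
  rewrite -eA.
  have -> : A ^+ 2 * (p%:~R - p'%:~R) ^+ 2 + - B ^+ 2 * (q%:~R - q'%:~R) ^+ 2 =
     ((p%:~R * A + q%:~R * B) - (p'%:~R * A + q'%:~R * B)) *
     ((p%:~R - p'%:~R) * A - (q%:~R - q'%:~R) * B) by ring.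
  by rewrite e subrr mul0r.
have hp : 0 <= P * (p - p') ^+ 2 by rewrite mulr_ge0 ?sqr_ge0 // ltW.
have hq : 0 <= Q * (q - q') ^+ 2 by rewrite mulr_ge0 ?sqr_ge0 // ltW.
move=> /eqP; rewrite paddr_eq0 // !mulf_eq0 !orbb !subr_eq0.
by rewrite (gt_eqF P0) (gt_eqF Q0) /= => /andP[/eqP -> /eqP ->].
Qed.

Lemma sqrt_pair (P Q : int) :
  exists A B : algC, A ^+ 2 = P%:~R /\ B ^+ 2 = - Q%:~R.
Proof. by exists (sqrtC P%:~R), (sqrtC (- Q%:~R)); rewrite !sqrtCK. Qed.

(** The integral form of alpha^(m n) = (alpha^m)^n, read off in the algebraic
numbers, where the coordinates are unique. *)
Lemma pow_comp (P Q p q : int) i j k : 0 < P -> 0 < Q ->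
  (2 * k).+1 = ((2 * i).+1 * (2 * j).+1)%N ->
  pow_re P Q k p q = pow_re P Q j (pow_re P Q i p q) (pow_im P Q i p q) /\
  pow_im P Q k p q = pow_im P Q j (pow_re P Q i p q) (pow_im P Q i p q).
Proof.
move=> P0 Q0 ek; have [A [B [eA eB]]] := sqrt_pair P Q.
apply: (quadratic_coords_inj P0 Q0 eA eB).
by rewrite -!(odd_power_rep _ _ _ eA eB) ek exprM.
Qed.

Lemma pow_1 (P Q p q : int) : pow_re P Q 0 p q = p /\ pow_im P Q 0 p q = q.
Proof.
by rewrite /pow_re /pow_im /Phi !big_ord1 bin0 !expr0 mulr1n !mulr1.
Qed.

Lemma pow_3 (P Q p q : int) :
  pow_re P Q 1 p q = p * (P * p ^+ 2 - 3 * (Q * q ^+ 2)) /\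
  pow_im P Q 1 p q = q * (3 * (P * p ^+ 2) - Q * q ^+ 2).
Proof. by rewrite /pow_re /pow_im !Phi_1; split; ring. Qed.

Lemma supported_coprimez (n p P : int) :
  coprimez n P -> supported_on p P -> coprimez n p.
Proof.
move=> cnP s; apply: coprimez_of_primes => q pq qn qp.
exact: coprimez_no_common_prime cnP pq qn (s q pq qp).
Qed.

(** With p = 0 the norm would be a multiple of Q. *)
Lemma coprimez_mulr_neq0 (P Q p q : int) : 2 <= Q ->
  coprimez (P * p ^+ 2 + Q * q ^+ 2) Q -> p != 0.
Proof.
move=> Q2; apply: contraTneq => ->; rewrite expr0n mulr0 add0r.
rewrite coprimezMl negb_and; apply/orP; left; rewrite /coprimez gcdzz; lia.
Qed.

Lemma pow_prime_exponent h (P Q p q : int) : prime (2 * h).+1 -> 2 <= P -> 2 <= Q ->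
  coprimez (P * p ^+ 2 + Q * q ^+ 2) P -> coprimez (P * p ^+ 2 + Q * q ^+ 2) Q ->
  supported_on (pow_re P Q h p q) P -> supported_on (pow_im P Q h p q) Q ->
  h = 1%N /\ exists nu, cubic_shape nu (P * p ^+ 2) (Q * q ^+ 2)
                     \/ cubic_shape nu (Q * q ^+ 2) (P * p ^+ 2).
Proof.
move=> pl P2 Q2 cP cQ sre sim.
have p0 := coprimez_mulr_neq0 Q2 cQ.
have q0 : q != 0.
  by move: cP; rewrite addrC; apply: coprimez_mulr_neq0 P2.
have cp := supported_coprimez cP (supported_factor sre).
have cX : coprimez (P * p ^+ 2 + Q * q ^+ 2) (P * p ^+ 2).
  by rewrite coprimezMr cP coprimezXr.
have cXY : coprimez (P * p ^+ 2) (Q * q ^+ 2).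
  apply: coprimez_of_primes => r pr rX rY.
  exact: coprimez_no_common_prime cX pr (rpredD rX rY) rX.
have X2 : 2 <= P * p ^+ 2.
  have : 1 <= p ^+ 2 by rewrite -gtz0_ge1 exprn_even_gt0.
  by move: P2; move: (p ^+ 2) => u; nia.
have Y2 : 2 <= Q * q ^+ 2.
  have : 1 <= q ^+ 2 by rewrite -gtz0_ge1 exprn_even_gt0.
  by move: Q2; move: (q ^+ 2) => u; nia.
apply: supported_prime_exponent => //; try lia.
- have : (P * p ^+ 2, Q * q ^+ 2) != (2, 2).
    by apply: contraTneq cXY => -[-> ->].
  rewrite xpair_eqE; move: X2 Y2; move: (P * _) (Q * _) => X Y; lia.
- move=> r pr rF; rewrite dvdz_mulr //; apply: sre => //.
  exact: dvdz_mull.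
- move=> r pr rF; rewrite dvdz_mulr //; apply: sim => //.
  exact: dvdz_mull.
Qed.

Lemma cubic_shape_factors nu X Y : cubic_shape nu X Y ->
  X - 3 * Y = - 3 ^+ nu /\ 3 * X - Y = - 1.
Proof. by case=> _ _; rewrite exprS; move: (3 ^+ nu) => T eX eY; lia. Qed.

(** Cubing produces X' = X (3^nu)^2.  It is divisible by 9, but 8X' + 3 or 8X' + 1
would have to be a power of 3 greater than 3, respectively 1. *)
Lemma cubic_shape_cubed nu nu' X Y : cubic_shape nu X Y ->
  ~ (cubic_shape nu' (X * (3 ^+ nu) ^+ 2) Y \/ cubic_shape nu' Y (X * (3 ^+ nu) ^+ 2)).
Proof.
move=> [_ nu1 _ _].
have -> : X * (3 ^+ nu) ^+ 2 = 9 * (X * (3 ^+ nu.-2) ^+ 2 * 9).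
  by case: nu nu1 => [|[|nu]] //= _; rewrite !exprS; ring.
move: (X * _ * 9) => Z [[_ nu'1 e _]|[_ _ _ e]].
  by case: nu' nu'1 e => [|[|nu']] //= _; rewrite !exprS; move: (3 ^+ nu') => T; lia.
by move: e; rewrite exprS; move: (3 ^+ nu') => T; lia.
Qed.

Lemma odd_divisor m l : odd m -> (l %| m)%N -> exists h, l = (2 * h).+1.
Proof.
move=> om lm; exists l./2; rewrite -[LHS]odd_double_half mul2n.
by rewrite (dvdn_odd lm om).
Qed.

(** Let alpha = p sqrt P + q sqrt (-Q), and write 2k + 1 = n l with l prime.  The
coordinates of alpha^(n l) are multiples of those of alpha^n, so the restriction
on prime divisors passes to the latter.  Hence l = 3 and alpha^n has the cubic
shape; if n > 1, the same argument makes alpha^n the cube of another element of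
cubic shape, against [cubic_shape_cubed]. *)
Lemma supported_pow_exponent k (P Q p q : int) : 2 <= P -> 2 <= Q ->
  coprimez (P * p ^+ 2 + Q * q ^+ 2) P -> coprimez (P * p ^+ 2 + Q * q ^+ 2) Q ->
  supported_on (pow_re P Q k p q) P -> supported_on (pow_im P Q k p q) Q ->
  k = 0%N \/ k = 1%N /\ exists nu, cubic_shape nu (P * p ^+ 2) (Q * q ^+ 2)
                     \/ cubic_shape nu (Q * q ^+ 2) (P * p ^+ 2).
Proof.
move=> P2 Q2 cP cQ sre sim.
have P0 : 0 < P by lia.
have Q0 : 0 < Q by lia.
have cop i R : coprimez (P * p ^+ 2 + Q * q ^+ 2) R ->
  coprimez (P * pow_re P Q i p q ^+ 2 + Q * pow_im P Q i p q ^+ 2) R.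
  by move=> cR; rewrite pow_norm coprimezXl.
have [->|k_gt0] := posnP k; [by left | right].
have split j : (0 < j)%N -> exists h i, prime (2 * h).+1 /\
    (2 * j).+1 = ((2 * i).+1 * (2 * h).+1)%N.
  move=> j_gt0.
  have pl : prime (pdiv (2 * j).+1) by apply: pdiv_prime; lia.
  have oj : odd (2 * j).+1 by rewrite /= oddM.
  have /dvdnP[i' ei] := pdiv_dvd (2 * j).+1.
  have [h eh] := odd_divisor oj (pdiv_dvd _).
  have [i eI] : exists i, i' = (2 * i).+1.
    by apply: odd_divisor oj _; rewrite ei dvdn_mulr.
  by exists h, i; split; rewrite -?eh // -eI.
have [h [i [pl ek]]] := split k k_gt0.
have [er eim] := pow_comp p q P0 Q0 ek.
rewrite er in sre; rewrite eim in sim.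
have [h1 [nu sh]] :=
  pow_prime_exponent pl P2 Q2 (cop i _ cP) (cop i _ cQ) sre sim.
have [i0|i_gt0] := posnP i.
  have [e1 e2] := pow_1 P Q p q.
  split; first by move: ek; rewrite i0 h1; lia.
  by exists nu; move: sh; rewrite i0 e1 e2.
exfalso.
have sre' := supported_factor sre.
have sim' := supported_factor sim.
have [h' [j [pl' ei]]] := split i i_gt0.
have [er' eim'] := pow_comp p q P0 Q0 ei.
move: sh; rewrite er' in sre' *; rewrite eim' in sim' *.
have [h1' [nu' sh']] :=
  pow_prime_exponent pl' P2 Q2 (cop j _ cP) (cop j _ cQ) sre' sim'.
rewrite h1'; have [-> ->] := pow_3 P Q (pow_re P Q j p q) (pow_im P Q j p q).
move: sh'; move: (pow_re _ _ _ _ _) (pow_im _ _ _ _ _) => a b.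
case=> sh'; have [e1 e2] := cubic_shape_factors sh';
  have no := cubic_shape_cubed (nu' := nu) sh'.
  rewrite e1 e2 !exprMn !sqrrN expr1n mulr1 mulrA => sh; exact: no.
have e1' : P * a ^+ 2 - 3 * (Q * b ^+ 2) = 1 by lia.
have e2' : 3 * (P * a ^+ 2) - Q * b ^+ 2 = 3 ^+ nu' by lia.
rewrite e1' e2' mulr1 exprMn [Q * (_ * _)]mulrA => sh; apply: no.
by case: sh; [right|left].
Qed.

(** * Representations in one class *)

(** The primed pair comes from the cube of an element: X' = X (X - 3Y)^2 and
Y' = Y (3X - Y)^2, where X - 3Y = - 3^nu and 3X - Y = -1. *)
Definition cubic_pair (X Y X' Y' : int) : Prop :=
  exists nu, [/\ cubic_shape nu X Y, X' = X * (3 ^+ nu) ^+ 2 & Y' = Y].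

Lemma supported_member_of_class c P Q z0 p0 q0 z p q :
  odd `|c| -> coprimez c P -> coprimez c Q -> c != 0 -> 2 <= P -> 2 <= Q ->
  (0 < z0)%N -> represents c P Q z0 p0 q0 ->
  (forall z p q, (0 < z)%N -> represents c P Q z p q ->
      (c %| p * q0 - p0 * q)%Z -> (z0 <= z)%N) ->
  (0 < z)%N -> represents c P Q z p q -> (c %| p * q0 - p0 * q)%Z ->
  supported_on p P -> supported_on q Q ->
  let X0 := P * p0 ^+ 2 in let Y0 := Q * q0 ^+ 2 in
  let X := P * p ^+ 2 in let Y := Q * q ^+ 2 in
  [\/ X = X0 /\ Y = Y0, cubic_pair X0 Y0 X Y | cubic_pair Y0 X0 Y X].
Proof.
move=> co cP cQ c0 P2 Q2 z0_gt0 r0 min0 z_gt0 r h sp sq X0 Y0 X Y.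
have P0 : 0 < P by lia.
have Q0 : 0 < Q by lia.
have [A [B [eA eB]]] := sqrt_pair P Q.
have [m [a [b [om eab]]]] := power_of_minimal co cP c0 P2 Q2 eA eB
  z0_gt0 r0 min0 z_gt0 r h.
have [k ->] := odd_divisor om (dvdnn m).
rewrite (odd_power_rep _ _ _ eA eB) => e.
have [ep eq] := quadratic_coords_inj P0 Q0 eA eB e.
have ea : P * a ^+ 2 = X0 by case: eab => -[-> _]; rewrite ?sqrrN.
have eb : Q * b ^+ 2 = Y0 by case: eab => -[_ ->]; rewrite ?sqrrN.
have en : P * a ^+ 2 + Q * b ^+ 2 = c ^+ z0 by rewrite ea eb; case: r0.
have cNP : coprimez (P * a ^+ 2 + Q * b ^+ 2) P by rewrite en coprimezXl.
have cNQ : coprimez (P * a ^+ 2 + Q * b ^+ 2) Q by rewrite en coprimezXl.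
rewrite ep in sp; rewrite eq in sq.
have [k0|[k1 [nu sh]]] := supported_pow_exponent P2 Q2 cNP cNQ sp sq.
  have [e1 e2] := pow_1 P Q a b.
  by apply: Or31; rewrite /X /Y ep eq k0 e1 e2.
have [e1 e2] := pow_3 P Q a b.
have eX : X = X0 * (X0 - 3 * Y0) ^+ 2.
  by rewrite /X ep k1 e1 ea eb -ea; ring.
have eY : Y = Y0 * (3 * X0 - Y0) ^+ 2.
  by rewrite /Y eq k1 e2 ea eb -eb; ring.
case: sh; rewrite ea eb => sh; have [f1 f2] := cubic_shape_factors sh.
  by apply: Or32; exists nu; split=> //; rewrite ?eX ?eY ?f1 ?f2 ?sqrrN // expr1n mulr1.
have f1' : 3 * X0 - Y0 = 3 ^+ nu by rewrite -opprB f1 opprK.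
have f2' : X0 - 3 * Y0 = 1 by rewrite -opprB f2 opprK.
by apply: Or33; exists nu; split=> //; rewrite ?eX ?eY ?f1' ?f2' // expr1n mulr1.
Qed.

Lemma cubic_shape_asym nu nu' X Y :
  cubic_shape nu X Y -> cubic_shape nu' Y X -> False.
Proof.
move=> [_ n1 e1 _] [_ _ _]; rewrite exprS; move: e1.
case: nu n1 => [|[|nu]] // _; rewrite !exprS.
by move: (3 ^+ nu) (3 ^+ nu') => T T'; lia.
Qed.

(** Both are powers of the same minimal element with exponent 1 or 3.  Equal
exponents give equal solutions; otherwise one is the cube of the other. *)
Lemma class_collision c P Q z1 p1 q1 z2 p2 q2 :
  odd `|c| -> coprimez c P -> coprimez c Q -> c != 0 -> 2 <= P -> 2 <= Q ->
  (0 < z1)%N -> represents c P Q z1 p1 q1 ->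
  (0 < z2)%N -> represents c P Q z2 p2 q2 ->
  (c %| p1 * q2 - p2 * q1)%Z ->
  supported_on p1 P -> supported_on q1 Q -> supported_on p2 P -> supported_on q2 Q ->
  let X1 := P * p1 ^+ 2 in let Y1 := Q * q1 ^+ 2 in
  let X2 := P * p2 ^+ 2 in let Y2 := Q * q2 ^+ 2 in
  X1 = X2 /\ Y1 = Y2 \/
  (cubic_pair X1 Y1 X2 Y2 \/ cubic_pair Y1 X1 Y2 X2) \/
  (cubic_pair X2 Y2 X1 Y1 \/ cubic_pair Y2 X2 Y1 X1).
Proof.
move=> co cP cQ c0 P2 Q2 z1_gt0 r1 z2_gt0 r2 h12 sp1 sq1 sp2 sq2 X1 Y1 X2 Y2.
have [z0 [p0 [q0 [z0_gt0 r0 h0 min1]]]] := minimal_representation z1_gt0 r1.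
have cq1 := represents_coprime_r cP z1_gt0 r1.
have cq0 := represents_coprime_r cP z0_gt0 r0.
have sym p q p' q' : (c %| p * q' - p' * q)%Z -> (c %| p' * q - p * q')%Z.
  by rewrite -rpredN opprB.
have h10 : (c %| p1 * q0 - p0 * q1)%Z by exact: sym.
have h20 : (c %| p2 * q0 - p0 * q2)%Z.
  by apply: orientation_trans cq1 _ h0; apply: sym.
have min0 z p q : (0 < z)%N -> represents c P Q z p q ->
    (c %| p * q0 - p0 * q)%Z -> (z0 <= z)%N.
  by move=> z_gt0 r h; apply: min1 z_gt0 r _; apply: orientation_trans cq0 h h10.
have := supported_member_of_class
  co cP cQ c0 P2 Q2 z0_gt0 r0 min0 z1_gt0 r1 h10 sp1 sq1.
have := supported_member_of_class
  co cP cQ c0 P2 Q2 z0_gt0 r0 min0 z2_gt0 r2 h20 sp2 sq2.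
rewrite -/X1 -/Y1 -/X2 -/Y2 /=.
move: (P * p0 ^+ 2) (Q * q0 ^+ 2) => X0 Y0.
have cubic_shape_inj nu nu' X Y : cubic_shape nu X Y ->
    cubic_shape nu' X Y -> 3 ^+ nu = 3 ^+ nu' :> int.
  by move=> [_ _ <- _] [_ _ <- _].
case=> [[-> ->]|[nu [sh -> ->]]|[nu [sh -> ->]]];
  case=> [[-> ->]|[nu' [sh' -> ->]]|[nu' [sh' -> ->]]].
- by left.
- by right; right; left; exists nu'.
- by right; right; right; exists nu'.
- by right; left; left; exists nu.
- by left; rewrite (cubic_shape_inj _ _ _ _ sh sh').
- by case: (cubic_shape_asym sh sh').
- by right; left; right; exists nu.
- by case: (cubic_shape_asym sh sh').
- by left; rewrite (cubic_shape_inj _ _ _ _ sh sh').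
Qed.

(** * Subgroups of the plane modulo 2 *)

Lemma int_subgroup_mul (S : int -> Prop) n k : S 0 ->
  (forall m n, S m -> S n -> S (m - n)) -> S n -> S (k * n).
Proof.
move=> S0 SB Sn; elim/int_ind: k => [|k IH|k IH]; first by rewrite mul0r.
  rewrite intS mulrDl mul1r addrC -[X in _ + X]opprK; apply: (SB) => //.
  by rewrite -[- n]add0r; apply: (SB).
by rewrite intS opprD mulrDl mulN1r addrC; apply: (SB).
Qed.

Lemma int_subgroup_cyclic (S : int -> Prop) : S 0 ->
  (forall m n, S m -> S n -> S (m - n)) ->
  exists2 d, S d & forall n, S n -> n = (n %/ d)%Z * d.
Proof.
move=> S0 SB.
have [h|h] := pselect (exists2 n, S n & n != 0); last first.
  exists 0 => // n Sn; apply/eqP; rewrite mulr0; apply/negPn/negP => n0.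
  by apply: h; exists n.
pose R m := `[< (0 < m)%N /\ S m%:Z >].
have exR : exists m, R m.
  have [n Sn n0] := h; exists `|n|%N; apply/asboolP; rewrite absz_gt0; split=> //.
  by rewrite abszE normrEsg; apply: int_subgroup_mul.
have [d /asboolP[d_gt0 Sd] min_d] := ex_minnP exR.
exists d%:Z => // n Sn; rewrite {1}(divz_eq n d).
have Sr : S (n %% d)%Z.
  by rewrite /modz; apply: (SB) => //; apply: int_subgroup_mul.
have d0 : d%:Z != 0 by rewrite -lt0n.
have r0 := modz_ge0 n d0; have rd := ltz_mod n d0.
suff -> : (n %% d)%Z = 0 by rewrite addr0.
apply/eqP/negPn/negP => rn0.
have : R `|(n %% d)%Z|%N.
  by apply/asboolP; rewrite absz_gt0 gez0_abs.
by move=> /min_d; rewrite leqNgt => /negP; apply; lia.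
Qed.

(** Triangular generators (u0, d) and (o, 0) of L, and the parities of the
coordinates in them.  If d or o is 0, division by it returns 0, which is the
right coordinate. *)
Lemma plane_subgroup_mod2 (L : int -> int -> Prop) : L 0 0 ->
  (forall u v u' v', L u v -> L u' v' -> L (u - u') (v - v')) ->
  exists k : int -> int -> bool * bool, forall u v u' v',
    L u v -> L u' v' -> k u v = k u' v' ->
    exists s t, [/\ L s t, u - u' = 2 * s & v - v' = 2 * t].
Proof.
move=> L0 LB.
have LM n u v : L u v -> L (n * u) (n * v).
  pose S n := L (n * u) (n * v).
  move=> Luv; rewrite -[n]mulr1; apply: (@int_subgroup_mul S).
  - by rewrite /S !mul0r.
  - by move=> i j Si Sj; rewrite /S !mulrBl; apply: (LB).
  - by rewrite /S !mul1r.
have LD u v u' v' : L u v -> L u' v' -> L (u + u') (v + v').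
  move=> Luv Luv'; rewrite -[u']opprK -[v']opprK; apply: (LB) => //.
  by rewrite -[- u']add0r -[- v']add0r; apply: (LB).
have [d [u0 L0d] divd] : exists2 d, (exists u, L u d) &
    forall v, (exists u, L u v) -> v = (v %/ d)%Z * d.
  apply: (@int_subgroup_cyclic (fun v => exists u, L u v)); first by exists 0.
  by move=> m n [u Lu] [u' Lu']; exists (u - u'); apply: (LB).
have [o Lo divo] : exists2 o, L o 0 & forall u, L u 0 -> u = (u %/ o)%Z * o.
  apply: (@int_subgroup_cyclic (fun u => L u 0)) => //.
  by move=> m n Lm Ln; rewrite -[X in L _ X](subrr 0); apply: (LB).
pose j u v := ((u - (v %/ d)%Z * u0) %/ o)%Z.
exists (fun u v => (odd `|(v %/ d)%Z|, odd `|j u v|)) => u v u' v' Luv Luv'.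
have even_diff (m n : int) : odd `|m| = odd `|n| -> exists k, m - n = 2 * k.
  by move=> e; exists ((m - n) %/ 2)%Z; lia.
case=> /even_diff[K eK] /even_diff[J eJ].
have eu x y : L x y -> x = (y %/ d)%Z * u0 + j x y * o /\ y = (y %/ d)%Z * d.
  move=> Lxy; have ey : y = (y %/ d)%Z * d by apply: divd; exists x.
  split=> //; rewrite /j -divo; first by rewrite addrC subrK.
  have -> : (0 : int) = y - (y %/ d)%Z * d by rewrite -ey subrr.
  by apply: (LB) => //; apply: (LM).
have [e1 e2] := eu _ _ Luv; have [e3 e4] := eu _ _ Luv'.
exists (K * u0 + J * o), (K * d + J * 0); split.
- by apply: (LD); apply: (LM).
- rewrite e1 e3.
  have -> : (v %/ d)%Z * u0 + j u v * o - ((v' %/ d)%Z * u0 + j u' v' * o) =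
    ((v %/ d)%Z - (v' %/ d)%Z) * u0 + (j u v - j u' v') * o by ring.
  rewrite eK eJ; ring.
- rewrite {1}e2 {1}e4 -mulrBl eK; ring.
Qed.

(** * From representations to solutions *)

(** [cubic_pair] over the natural numbers, for a given nu. *)
Definition cubic_pair_nat (nu X Y X' Y' : nat) : Prop :=
  [/\ odd nu, (1 < nu)%N, (8 * X + 3 = 3 ^ nu)%N, (8 * Y + 1 = 3 ^ nu.+1)%N
    & (X' = X * (3 ^ nu) ^ 2)%N /\ Y' = Y].

Lemma cubic_pair_to_nat (X Y X' Y' : nat) :
  cubic_pair X Y X' Y' -> exists nu, cubic_pair_nat nu X Y X' Y'.
Proof.
have pw k : (3 : int) ^+ k = (3 ^ k)%N by rewrite -natz natrX.
move=> [nu [[o n1 eX eY] eX' eY']]; exists nu; move: eX eY eX' eY'.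
rewrite !pw => eX eY eX' eY'; split=> //; try lia.
Qed.

Lemma coprime_summand c r a s b x y z : coprime c (r * a) ->
  (0 < x)%N -> (0 < z)%N -> (r * a ^ x + s * b ^ y = c ^ z)%N ->
  coprime c (r * a ^ x) /\ coprime c (s * b ^ y).
Proof.
rewrite coprimeMr => /andP[cr ca] x0 z0 e.
have cX : coprime c (r * a ^ x) by rewrite coprimeMr cr coprimeXr.
split=> //; rewrite /coprime -dvdn1 -(eqP cX) dvdn_gcd dvdn_gcdl /=.
rewrite -(dvdn_addl _ (dvdn_gcdr c (s * b ^ y))) e.
exact: dvdn_trans (dvdn_gcdl _ _) (dvdn_exp z0 (dvdnn c)).
Qed.

(** The positive exponents x0 and y0 matter: they put every prime divisor of a into
P = r a^x0 and every prime divisor of b into Q = s b^y0. *)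
Lemma solution_collision (r s a b c x0 y0 u1 v1 z1 u2 v2 z2 : nat) :
  (0 < r)%N -> (0 < s)%N -> (1 < a)%N -> (1 < b)%N -> odd c ->
  coprime c (r * a) -> (0 < x0)%N -> (0 < y0)%N ->
  is_solution r s a b c (x0 + 2 * u1) (y0 + 2 * v1) z1 ->
  is_solution r s a b c (x0 + 2 * u2) (y0 + 2 * v2) z2 ->
  (a ^ u1 * b ^ v2 = a ^ u2 * b ^ v1 %[mod c])%N ->
  let X1 := (r * a ^ (x0 + 2 * u1))%N in let Y1 := (s * b ^ (y0 + 2 * v1))%N in
  let X2 := (r * a ^ (x0 + 2 * u2))%N in let Y2 := (s * b ^ (y0 + 2 * v2))%N in
  X1 = X2 /\ Y1 = Y2 \/
  (exists nu, cubic_pair_nat nu X1 Y1 X2 Y2 \/ cubic_pair_nat nu Y1 X1 Y2 X2) \/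
  (exists nu, cubic_pair_nat nu X2 Y2 X1 Y1 \/ cubic_pair_nat nu Y2 X2 Y1 X1).
Proof.
move=> r0 s0 a1 b1 co cra x0_gt0 y0_gt0 [_ _ z1_gt0 e1] [_ _ z2_gt0 e2] emod.
move=> X1 Y1 X2 Y2.
pose P := (r * a ^ x0)%N; pose Q := (s * b ^ y0)%N.
have eX1 : X1 = (P * (a ^ u1) ^ 2)%N.
  by rewrite /X1 /P expnD mulnA -expnM [(u1 * 2)%N]mulnC.
have eX2 : X2 = (P * (a ^ u2) ^ 2)%N.
  by rewrite /X2 /P expnD mulnA -expnM [(u2 * 2)%N]mulnC.
have eY1 : Y1 = (Q * (b ^ v1) ^ 2)%N.
  by rewrite /Y1 /Q expnD mulnA -expnM [(v1 * 2)%N]mulnC.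
have eY2 : Y2 = (Q * (b ^ v2) ^ 2)%N.
  by rewrite /Y2 /Q expnD mulnA -expnM [(v2 * 2)%N]mulnC.
have [cX1 cY1] := coprime_summand cra (ltn_addr _ x0_gt0) z1_gt0 e1.
have [cX2 cY2] := coprime_summand cra (ltn_addr _ x0_gt0) z2_gt0 e2.
rewrite -/X1 -/X2 -/Y1 -/Y2 in cX1 cX2 cY1 cY2 e1 e2.
have cP : coprimez c P by rewrite coprimezE; move: cX1; rewrite eX1 coprimeMr => /andP[].
have cQ : coprimez c Q by rewrite coprimezE; move: cY1; rewrite eY1 coprimeMr => /andP[].
have big (k n m : nat) : (0 < k)%N -> (1 < n)%N -> (0 < m)%N ->
    (2 <= (k * n ^ m)%N%:Z)%R.
  move=> k0 n1 m0; rewrite (_ : 2 = 2%N%:Z) // lez_nat.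
  apply: leq_trans (leq_pmull _ k0); apply: leq_trans (n1) _.
  by rewrite -[X in (X <= _)%N]expn1 leq_exp2l.
have rep (X Y z p q : nat) : (X = P * p ^ 2)%N -> (Y = Q * q ^ 2)%N ->
    (X + Y = c ^ z)%N -> coprime c X -> represents c P Q z p q.
  move=> eX eY e cX; split; last first.
    by rewrite coprimezE; move: cX; rewrite eX coprimeMr coprime_pexpr // => /andP[].
  by rewrite !expr2 -!PoszM !mulnn -PoszD -eX -eY e -natz natrX natz.
have supp (k n u m : nat) : (0 < m)%N -> supported_on (n ^ u)%N (k * n ^ m)%N.
  move=> m0 q pq; rewrite !dvdzE /= => qn; apply: dvdn_mull.
  by rewrite Euclid_dvdX // m0 andbT; move: qn; rewrite Euclid_dvdX // => /andP[].
have hor : (c %| (a ^ u1)%N%:Z * (b ^ v2)%N - (a ^ u2)%N%:Z * (b ^ v1)%N)%Z.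
  by rewrite -eqz_mod_dvd -!PoszM !modz_nat eqz_nat; apply/eqP.
have c0 : c%:Z != 0 by rewrite -lt0n odd_gt0.
have := @class_collision c P Q z1 (a ^ u1)%N (b ^ v1)%N z2 (a ^ u2)%N (b ^ v2)%N
  co cP cQ c0
  (big _ _ _ r0 a1 x0_gt0) (big _ _ _ s0 b1 y0_gt0)
  z1_gt0 (rep _ _ _ _ _ eX1 eY1 e1 cX1) z2_gt0 (rep _ _ _ _ _ eX2 eY2 e2 cX2)
  hor (supp _ _ _ _ x0_gt0) (supp _ _ _ _ y0_gt0)
  (supp _ _ _ _ x0_gt0) (supp _ _ _ _ y0_gt0).
rewrite /= !expr2 -!PoszM !mulnn -eX1 -eX2 -eY1 -eY2.
case=> [[[->] [->]]|[[]|[]]]; first by left.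
- by move=> /cubic_pair_to_nat[nu h]; right; left; exists nu; left.
- by move=> /cubic_pair_to_nat[nu h]; right; left; exists nu; right.
- by move=> /cubic_pair_to_nat[nu h]; right; right; exists nu; left.
- by move=> /cubic_pair_to_nat[nu h]; right; right; exists nu; right.
Qed.

Local Open Scope nat_scope.

(** * The exceptional family *)

(** The quotient of the two powers of a is 9^nu, so a is a power of 3; and 9 cannot
divide r a^x, because 8 r a^x + 3 is divisible by 9. *)
Lemma cubic_pair_base r a x x' nu Y Y' : 0 < r -> 1 < a -> 0 < x ->
  cubic_pair_nat nu (r * a ^ x) Y (r * a ^ x') Y' -> a = 3.
Proof.
move=> r0 a1 x0 [_ n1 e _ [e' _]].
have ax0 : 0 < r * a ^ x by rewrite muln_gt0 r0 expn_gt0 ltnW.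
have lt_x : x < x'.
  rewrite -(ltn_exp2l _ _ a1) -(ltn_pmul2l r0) e' -[X in X < _]muln1.
  by rewrite ltn_pmul2l // -expnM -[X in X < _](expn0 3) ltn_exp2l // muln_gt0 ltnW.
have ed : a ^ (x' - x) = 3 ^ (nu * 2).
  apply/eqP; rewrite -(eqn_pmul2l ax0) -mulnA -expnD subnKC ?(ltnW lt_x) //.
  by rewrite e' expnM.
have n9 : ~~ (9 %| a).
  apply/negP => /dvdnP[k ek]; move: e; rewrite -(prednK x0) expnS {1}ek.
  case: nu n1 {e' ed} => [|[|nu]] // _; rewrite !expnS.
  by move: (a ^ _) (3 ^ nu) => A T; rewrite -!mulnA mulnCA; nia.
have pa : 3.-nat a.
  apply/pnatP; first exact: ltnW.
  move=> q pq qa; rewrite inE /=.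
  have : q %| 3 ^ (nu * 2) by rewrite -ed Euclid_dvdX // qa subn_gt0.
  by rewrite Euclid_dvdX // dvdn_prime2 // => /andP[].
have [[|[|j]] ej] := p_natP pa; first by rewrite ej in a1.
  by rewrite ej.
by move: n9; rewrite ej !expnS mulnA dvdn_mulr.
Qed.

(** The solution t' belongs to the cube of the element that belongs to t. *)
Definition cube_of r s a b (t t' : nat * nat * nat) : Prop :=
  exists nu,
  cubic_pair_nat nu (r * a ^ t.1.1) (s * b ^ t.1.2) (r * a ^ t'.1.1) (s * b ^ t'.1.2) \/
  cubic_pair_nat nu (s * b ^ t.1.2) (r * a ^ t.1.1) (s * b ^ t'.1.2) (r * a ^ t'.1.1).

Lemma cube_of_exceptional r s a b c t t' : 0 < r -> 0 < s -> 1 < a -> 1 < b ->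
  solutions r s a b c t -> cube_of r s a b t t' -> exceptional r s a b c.
Proof.
move: t t' => [[x y] z] [[x' y'] z'] r0 s0 a1 b1 sol [nu]; rewrite /=.
have [x0 y0 _ _] := sol.
have val nu0 X Y X' Y' : cubic_pair_nat nu0 X Y X' Y' ->
    X = 3 * ((3 ^ (nu0 - 1) - 1) %/ 8) /\ Y = (3 ^ (nu0 + 1) - 1) %/ 8.
  move=> [_ n1 eX eY _]; rewrite addn1 -eY; split; last first.
    by rewrite addnK mulKn.
  case: nu0 n1 eX {eY} => [//|n] _; rewrite expnS subSS subn0.
  move: (3 ^ n) => T; lia.
case=> tw; split.
- by left; exact: cubic_pair_base tw.
- exists x, y, z, nu; have [<- <-] := val _ _ _ _ _ tw.
  by case: tw.
- by right; exact: cubic_pair_base tw.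
- exists x, y, z, nu; have [<- <-] := val _ _ _ _ _ tw.
  by case: tw => *; split=> // k; rewrite !inE orbC.
Qed.

Lemma solution_gt1 r s a b c x y z : 0 < r -> 0 < s -> 1 < a -> 1 < b ->
  is_solution r s a b c x y z -> 1 < c.
Proof.
move=> r0 s0 a1 b1 [_ _ z0 e].
have X0 : 0 < r * a ^ x by rewrite muln_gt0 r0 expn_gt0 ltnW.
have Y0 : 0 < s * b ^ y by rewrite muln_gt0 s0 expn_gt0 ltnW.
have : 1 < c ^ z by rewrite -e (leq_add X0 Y0).
by case: (c) => [|[|]] //; rewrite ?exp0n // exp1n.
Qed.

Lemma solution_inj r s a b c x y z x' y' z' :
  0 < r -> 0 < s -> 1 < a -> 1 < b ->
  is_solution r s a b c x y z -> is_solution r s a b c x' y' z' ->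
  r * a ^ x = r * a ^ x' -> s * b ^ y = s * b ^ y' -> (x, y, z) = (x', y', z').
Proof.
move=> r0 s0 a1 b1 st [_ _ _ e'] eX eY.
have c1 := solution_gt1 r0 s0 a1 b1 st; have [_ _ _ e] := st.
have ez : z = z' by apply: (expnI c1); rewrite -e -e' eX eY.
have ex : x = x' by apply: (expnI a1); apply/eqP; rewrite -(eqn_pmul2l r0) eX.
have ey : y = y' by apply: (expnI b1); apply/eqP; rewrite -(eqn_pmul2l s0) eY.
by rewrite ex ey ez.
Qed.

(** Since 9 does not divide r 3^x, both exponents are equal to one minus the
multiplicity of 3 in r; then nu, and with it everything else, is determined. *)
Lemma cubic_pair_unique r x1 x2 nu1 nu2 Y1 X1' Y1' Y2 X2' Y2' : 0 < x1 -> 0 < x2 ->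
  cubic_pair_nat nu1 (r * 3 ^ x1) Y1 X1' Y1' -> cubic_pair_nat nu2 (r * 3 ^ x2) Y2 X2' Y2' ->
  X1' = X2' /\ Y1' = Y2'.
Proof.
have le u1 u2 m1 m2 W1 Z1 V1 W2 Z2 V2 : 0 < u1 ->
    cubic_pair_nat m1 (r * 3 ^ u1) W1 Z1 V1 -> cubic_pair_nat m2 (r * 3 ^ u2) W2 Z2 V2 ->
    u2 <= u1.
  move=> u0 _ [_ n2 e2 _ _]; rewrite leqNgt; apply/negP => lt.
  have /subnKC eu : 2 <= u2 by apply: leq_trans lt.
  move: e2; rewrite -eu expnD; case: m2 n2 => [|[|m]] // _; rewrite !expnS.
  by move: (3 ^ m) (3 ^ _) => T U; nia.
move=> x1_0 x2_0 tw1 tw2.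
have ex : x1 = x2.
  by apply/eqP; rewrite eqn_leq (le _ _ _ _ _ _ _ _ _ _ x2_0 tw2 tw1)
    (le _ _ _ _ _ _ _ _ _ _ x1_0 tw1 tw2).
case: tw1 => _ _ e1 f1 [-> ->]; case: tw2 => _ _ e2 f2 [-> ->].
have en : nu1 = nu2 by apply: (@expnI 3) => //; rewrite -e1 -e2 ex.
split; first by rewrite ex en.
by apply/eqP; rewrite -(eqn_pmul2l (isT : 0 < 8)) -(eqn_add2r 1) f1 f2 en.
Qed.

(** * Counting the solutions *)

Lemma half_difference (x x' : nat) (s : int) : (0 < x)%N -> (0 < x')%N ->
  (x%:Z - x'%:Z = 2 * s)%R ->
  exists x0 u u' : nat, [/\ (0 < x0)%N, x = (x0 + 2 * u)%N, x' = (x0 + 2 * u')%N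
    & (s = u%:Z - u'%:Z)%R].
Proof.
move=> x_gt0 x'_gt0 e; have [s0|s0] := leP 0%R s.
  by exists x', `|s|%N, 0%N; split=> //; lia.
by exists x, 0%N, `|s|%N; split=> //; lia.
Qed.

(** The class of a solution is that of its difference from a fixed solution; only
differences lie in L. *)
Lemma solution_classes r s a b c : 0 < r -> 0 < s -> 1 < a -> 1 < b ->
  odd c -> coprime c (r * a) ->
  exists k : nat * nat * nat -> bool * bool, forall t t',
    solutions r s a b c t -> solutions r s a b c t' -> k t = k t' ->
    t = t' \/ cube_of r s a b t t' \/ cube_of r s a b t' t.
Proof.
move=> r0 s0 a1 b1 co cra.
have [[[[xb yb] zb] solb]|none] := pselect (exists t, solutions r s a b c t); last first.
  by exists (fun=> (true, true)) => t t' st; case: none; exists t.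
have [xb0 yb0 zb0 eb] := solb; rewrite /= in xb0 yb0 zb0 eb.
have [cX cY] := coprime_summand cra xb0 zb0 eb.
have c1 := solution_gt1 r0 s0 a1 b1 solb.
pose A : 'Z_c := a%:R%R; pose B : 'Z_c := b%:R%R.
have [ur uA] : (r%:R : 'Z_c)%R \is a GRing.unit /\ A \is a GRing.unit.
  by move: cra; rewrite coprimeMr /A !unitZpE // => /andP[].
have [us uB] : (s%:R : 'Z_c)%R \is a GRing.unit /\ B \is a GRing.unit.
  by move: cY; rewrite coprimeMr coprime_pexpr // /B !unitZpE // => /andP[].
pose L (u v : int) := (A ^ u = B ^ v)%R.
have LB u v u' v' : L u v -> L u' v' -> L (u - u')%R (v - v')%R.
  by rewrite /L => e e'; rewrite !exprzDr // -!invr_expz e e'.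
have [k hk] := @plane_subgroup_mod2 L (erefl _) LB.
have expB (C : 'Z_c) (m n : nat) : (C \is a GRing.unit)%R ->
    (C ^ (m%:Z - n%:Z) * C ^+ n = C ^+ m)%R.
  by move=> uC; rewrite exprnP -exprzDr // subrK.
have solL x y z : is_solution r s a b c x y z -> L (x%:Z - xb%:Z)%R (y%:Z - yb%:Z)%R.
  have zero x1 y1 z1 : is_solution r s a b c x1 y1 z1 ->
      (r%:R * A ^+ x1 = - (s%:R * B ^+ y1) :> 'Z_c)%R.
    move=> [_ _ z1_gt0 e]; apply/eqP; rewrite -addr_eq0 /A /B -!natrX -!natrM -natrD e.
    by rewrite natrX char_Zp // expr0n (gtn_eqF z1_gt0).
  move=> sol; have e1 := zero _ _ _ sol; have e2 := zero _ _ _ solb.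
  have uAB : (A ^+ xb * B ^+ yb)%R \is a GRing.unit by rewrite unitrM !unitrX.
  have uRS : (r%:R * s%:R : 'Z_c)%R \is a GRing.unit by rewrite unitrM ur.
  apply: (mulIr uAB); rewrite mulrA (expB _ _ _ uA) [RHS]mulrCA (expB _ _ _ uB).
  apply: (mulrI uRS); rewrite mulrACA e1 [RHS]mulrACA e2 2!mulNr.
  by congr (- _)%R; rewrite mulrC.
exists (fun t => k (t.1.1%:Z - xb%:Z)%R (t.1.2%:Z - yb%:Z)%R).
move=> [[x y] z] [[x' y'] z'] /= st st' ek.
have [u [v [Luv eu ev]]] := hk _ _ _ _ (solL _ _ _ st) (solL _ _ _ st') ek.
have [x_gt0 y_gt0 _ _] := st; have [x'_gt0 y'_gt0 _ _] := st'.
rewrite /= in x_gt0 y_gt0 x'_gt0 y'_gt0.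
have eu' : (x%:Z - x'%:Z = 2 * u)%R by rewrite -eu; ring.
have ev' : (y%:Z - y'%:Z = 2 * v)%R by rewrite -ev; ring.
have [x0 [u1 [u2 [x0_gt0 ex ex' eu12]]]] := half_difference x_gt0 x'_gt0 eu'.
have [y0 [v1 [v2 [y0_gt0 ey ey' ev12]]]] := half_difference y_gt0 y'_gt0 ev'.
have emod : a ^ u1 * b ^ v2 = a ^ u2 * b ^ v1 %[mod c].
  have : (A ^+ u1 * B ^+ v2 = A ^+ u2 * B ^+ v1)%R.
    rewrite -(expB _ u1 u2 uA) -(expB _ v1 v2 uB) -eu12 -ev12 Luv; ring.
  rewrite /A /B -!natrX -!natrM => /(congr1 (@nat_of_ord _)).
  by rewrite !val_Zp_nat.
rewrite ex ey in st; rewrite ex' ey' in st'.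
have := solution_collision r0 s0 a1 b1 co cra x0_gt0 y0_gt0 st st' emod.
rewrite /cube_of /= -ex -ey -ex' -ey'; case=> [[eX eY]|h]; last by right.
left; rewrite ex ex' ey ey' in eX eY *.
exact: solution_inj r0 s0 a1 b1 st st' eX eY.
Qed.

(** If a = b = 3 then 3 would divide X + Y = c^z, but c is coprime to a.  So both
exceptional pairs have the power of 3 on the same side, and
[cubic_pair_unique] applies. *)
Lemma cube_of_unique r s a b c t1 t1' t2 t2' :
  0 < r -> 0 < s -> 1 < a -> 1 < b -> coprime c (r * a) ->
  solutions r s a b c t1 -> solutions r s a b c t1' ->
  solutions r s a b c t2 -> solutions r s a b c t2' ->
  cube_of r s a b t1 t1' -> cube_of r s a b t2 t2' -> t1' = t2'.
Proof.
move: t1 t1' t2 t2' => [[x1 y1] z1] [[x1' y1'] z1'] [[x2 y2] z2] [[x2' y2'] z2'].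
move=> r0 s0 a1 b1 cra st1 st1' st2 st2'.
have [x1_0 y1_0 z1_0 e1] := st1; have [x2_0 y2_0 _ _] := st2.
have not33 : ~ (a = 3 /\ b = 3).
  move=> [a3 b3]; have [cX cY] := coprime_summand cra x1_0 z1_0 e1.
  rewrite /= in x1_0 y1_0 z1_0 e1.
  have d3 : 3 %| c ^ z1.
    rewrite -e1 a3 b3 -(prednK x1_0) -(prednK y1_0) !expnS.
    by rewrite dvdn_add // dvdn_mull // dvdn_mulr.
  move: d3 cra; rewrite a3 Euclid_dvdX // => /andP[/dvdnP[m ->] _].
  by rewrite mulnC coprimeMl => /andP[]; rewrite coprimeMr => /andP[].
move=> [n1 tw1] [n2 tw2]; rewrite /= in tw1 tw2.
suff [eX eY] : r * a ^ x1' = r * a ^ x2' /\ s * b ^ y1' = s * b ^ y2'.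
  exact: solution_inj r0 s0 a1 b1 st1' st2' eX eY.
case: tw1 tw2 => tw1 [] tw2.
- have a3 := cubic_pair_base r0 a1 x1_0 tw1.
  by subst a; apply: cubic_pair_unique tw1 tw2.
- case: not33; split; first exact: cubic_pair_base tw1.
  exact: cubic_pair_base tw2.
- case: not33; split; first exact: cubic_pair_base tw2.
  exact: cubic_pair_base tw1.
- have b3 := cubic_pair_base s0 b1 y1_0 tw1; subst b.
  by have [] := cubic_pair_unique y1_0 y2_0 tw1 tw2.
Qed.

Lemma card_le_code (T : Type) (S : set T) n (f : T -> nat) :
  (forall t, S t -> f t < n) ->
  (forall t t', S t -> S t' -> f t = f t' -> t = t') -> (S #<= `I_n)%classic.
Proof.
move=> lt inj; apply/pcard_leP/injfunPex; exists f => // t t'.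
by rewrite !inE; apply: inj.
Qed.

Unset Implicit Arguments.

Theorem corollary1 (r s a b c : nat)
    (hr : 0 < r) (hs : 0 < s) (ha : 1 < a) (hb : 1 < b)
    (hc : 0 < c) (hodd : odd c) (hcop : coprime c (r * a)) :
  (~ exceptional r s a b c -> (solutions r s a b c #<= `I_4)%classic) /\
  (exceptional r s a b c -> (solutions r s a b c #<= `I_5)%classic).
Proof.
have [k hk] := solution_classes hr hs ha hb hodd hcop.
pose f t := 2 * (k t).1 + (k t).2.
have flt t : f t < 4 by rewrite /f; case: (k t) => [[] []].
have finj t t' : f t = f t' -> k t = k t'.
  by rewrite /f; case: (k t) (k t') => [[] []] [[] []].
split=> [nexc|_].
  apply: (card_le_code (f := f)) => [t _|t t' st st' /finj e]; first exact: flt.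
  have [//|[d|d]] := hk _ _ st st' e.
    by case: nexc; apply: cube_of_exceptional hr hs ha hb st d.
  by case: nexc; apply: cube_of_exceptional hr hs ha hb st' d.
(* the fifth code is reserved for the cube above the exceptional solution *)
pose isder t := exists2 t0, solutions r s a b c t0 & cube_of r s a b t0 t.
apply: (card_le_code (f := fun t => if `[< isder t >] then 4 else f t)).
  by move=> t _ /=; case: asboolP => // _; apply: ltn_trans (flt t) _.
move=> t t' st st' /=.
case: (asboolP (isder t)) => [[t0 s0 d0]|n];
  case: (asboolP (isder t')) => [[t1 s1 d1]|n'] e.
- exact: cube_of_unique hr hs ha hb hcop s0 st s1 st' d0 d1.
- by have := flt t'; rewrite -e.
- by have := flt t; rewrite e.
- have [//|[d|d]] := hk _ _ st st' (finj _ _ e).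
    by case: n'; exists t.
  by case: n; exists t'.
Qed.
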